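(* Let $n,p$ be positive integers such that $p$ is odd and $n$ and $n+p$ are relatively prime. Let $\gamma_{n,p}(t)=(\sin(nt),\sin((n+p)t))$ and $t_k=\frac{2\pi k}{4n(n+p)}$ for $k\in\mathbb{Z}$. Then the operator \[ \operatorname{E}_\gamma:\Pi^L_{n,p}\to\Pi^{\mathrm{trig},L}_{2n(n+p)},\qquad \operatorname{E}_\gamma P(t)=P(\gamma_{n,p}(t)),\ t\in[0,2\pi], \] is an isometric isomorphism from $\Pi^L_{n,p}$ equipped with the inner product $\langle f,g\rangle=\frac{1}{\pi^2}\int_{-1}^1\int_{-1}^1 f(x,y)\overline{g(x,y)}\frac{1}{\sqrt{1-x^2}\sqrt{1-y^2}}\,dx\,dy$ onto $\Pi^{\mathrm{trig},L}_{2n(n+p)}$ equipped with the inner product $\langle q_1,q_2\rangle=\frac{1}{2\pi}\int_0^{2\pi}q_1(t)\overline{q_2(t)}\,dt$.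
   Context: $T_i(x)=\cos(i\arccos x)$ is the Chebyshev polynomial of the first kind. The index set is $\Gamma^L_{n,p}=\{(i,j)\in\mathbb{N}_0^2: i+j\le 2n\}\cup\bigcup_{m=1}^{2p-1}\{(i,j)\in\mathbb{N}_0^2: i+j=2n+m,\ j<\frac{n(2p-m)}{p}\}$, and $\Pi^L_{n,p}=\operatorname{span}\{T_i(x)T_j(y):(i,j)\in\Gamma^L_{n,p}\}$ (real coefficients). Let $\Pi^{\mathrm{trig}}_{2n(n+p)}$ be the space of functions $q(t)=\sum_{m=0}^{2n(n+p)}a_m\cos(mt)+\sum_{m=1}^{2n(n+p)-1}b_m\sin(mt)$ with $a_m,b_m\in\mathbb{R}$, and let $\Pi^{\mathrm{trig},L}_{2n(n+p)}=\{q\in\Pi^{\mathrm{trig}}_{2n(n+p)}: q(t_k)=q(t_{k'})\text{ for all }k,k'\in\mathbb{Z}\text{ with }\gamma_{n,p}(t_k)=\gamma_{n,p}(t_{k'})\}$. *)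

(* Defs.v *)
From HB Require Import structures.
From mathcomp Require Import all_boot all_order all_algebra.
From mathcomp Require Import all_classical all_reals all_analysis.
Set Implicit Arguments. Unset Strict Implicit. Unset Printing Implicit Defensive.
Import Order.TTheory GRing.Theory Num.Theory.
Local Open Scope ring_scope.
Local Open Scope classical_set_scope.

Section Defs.
Variable R : realType.

Definition cheb (i : nat) (x : R) : R := cos (i%:R * acos x).

(* membership in the index set Gamma^L_{n,p};
   j < n(2p-m)/p is written j*p < n*(2p-m) (p > 0, m < 2p) *)
Definition GammaL (n p i j : nat) : bool :=
  ((i + j <= 2 * n)%N) ||
  [exists m : 'I_(2 * p), [&& (0 < m)%N, (i + j == 2 * n + m)%N
                              & (j * p < n * (2 * p - m))%N]].

(* Pi^L_{n,p}: real span of (x,y) |-> T_i(x) T_j(y), (i,j) in Gamma^L_{n,p}.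
   Gamma^L_{n,p} is contained in [0, 2n+2p)^2. *)
Definition PiL (n p : nat) (f : R -> R -> R) : Prop :=
  exists c : nat -> nat -> R,
    forall x y, f x y = \sum_(i < 2 * n + 2 * p) \sum_(j < 2 * n + 2 * p)
       (if GammaL n p i j then c i j * cheb i x * cheb j y else 0).

Definition PiTrig (N : nat) (q : R -> R) : Prop :=
  exists a b : nat -> R,
    forall t, q t = \sum_(m < N.+1) a m * cos (m%:R * t)
                    + \sum_(1 <= m < N) b m * sin (m%:R * t).

Definition gamma (n p : nat) (t : R) : R * R :=
  (sin (n%:R * t), sin ((n + p)%:R * t)).

Definition tk (n p : nat) (k : int) : R :=
  2 * pi * k%:~R / (4 * n * (n + p))%:R.

Definition PiTrigL (n p : nat) (q : R -> R) : Prop :=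
  PiTrig (2 * n * (n + p)) q /\
  forall k k' : int, gamma n p (tk n p k) = gamma n p (tk n p k') ->
    q (tk n p k) = q (tk n p k').

Definition Egamma (n p : nat) (P : R -> R -> R) : R -> R :=
  fun t => P (gamma n p t).1 (gamma n p t).2.

(* Chebyshev-weighted inner product on [-1,1]^2 (real-valued functions, so
   complex conjugation is the identity) *)
Definition ipCheb (f g : R -> R -> R) : \bar R :=
  ((pi ^+ 2)^-1)%:E *
  \int[lebesgue_measure]_(x in `[(-1 : R)%R, (1 : R)%R]%classic)
    \int[lebesgue_measure]_(y in `[(-1 : R)%R, (1 : R)%R]%classic)
      (f x y * g x y / (Num.sqrt (1 - x ^+ 2) * Num.sqrt (1 - y ^+ 2)))%:E.

Definition ipTrig (q1 q2 : R -> R) : \bar R :=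
  ((2 * pi)^-1)%:E *
  \int[lebesgue_measure]_(t in `[(0 : R)%R, (2 * pi : R)%R]%classic) (q1 t * q2 t)%:E.

End Defs.

(* Main.v *)
(* On the curve, x = cos A and y = cos B with A = n t - pi/2 and
   B = (n+p) t - pi/2, so T_i(x) T_j(y) restricts to cos(iA) cos(jB), while
   (i,j) is in Gamma^L iff n i + (n+p) j < 2n(n+p) or (i,j) = (0,2n).

   Isometry: by the product formula it suffices to average cos(uA) cos(vB) with
   u = |i +- k|, v = |j +- l|. The average over the curve agrees with the one
   over the square unless (u,v) = a (n+p, n) with a > 0; for a = 1 the extra
   term is cos(p pi/2) = 0, and a >= 2 is excluded by the shape of Gamma^L.
   Injectivity follows since the Gram matrix is diagonal and positive.

   Surjectivity: each node t_k has a mirror node with the same point on the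
   curve, where B is replaced by -B (if k = n mod 2) or A by -A (otherwise).
   Averaging q over mirror nodes turns the frequency n i + (n+p) j into
   cos(iA) cos(jB) plus sin(iA) cos(jB), resp. cos(iA) sin(jB), and both mixed
   terms equal the same multiple of cos((n+p-i)A) cos((n+j)B) at the nodes. All
   cos(iA) cos(jB) reduce at the nodes to indices in Gamma^L by periodicity and
   by (i,j) -> (2(n+p)-i, 2n-j). Finally q and the resulting trace agree at the
   4n(n+p) nodes, hence everywhere. *)
Require Import Defs.
From HB Require Import structures.
From mathcomp Require Import all_boot all_order all_algebra.
From mathcomp Require Import all_classical all_reals all_analysis measurable_realfun.
From mathcomp Require Import zify ring lra.
Set Implicit Arguments. Unset Strict Implicit. Unset Printing Implicit Defensive.
Import Order.TTheory GRing.Theory Num.Theory.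
Import numFieldNormedType.Exports.
Local Open Scope classical_set_scope.
Local Open Scope ring_scope.

(** * Trigonometric identities and Chebyshev polynomials at cosines *)

Section Trigonometry.
Variable R : realType.
Implicit Types (a b x : R) (l : int).

Lemma cos_mul_cos a b : cos a * cos b = (cos (a + b) + cos (a - b)) / 2.
Proof. by rewrite cosD cosB; field. Qed.

Lemma sin_int_pi l : sin (l%:~R * pi) = 0 :> R.
Proof.
have H (n : nat) : sin (n%:R * pi) = 0 :> R.
  elim: n => [|n IH]; first by rewrite mul0r sin0.
  by rewrite -natr1 mulrDl mul1r sinDpi IH oppr0.
by case: l => n; [exact: H | rewrite NegzE mulrNz mulNr sinN H oppr0].
Qed.

Lemma sqr_cos_int_pi l : cos (l%:~R * pi) ^+ 2 = 1 :> R.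
Proof. by rewrite cos2sin2 sin_int_pi expr0n subr0. Qed.

Lemma cosD_int_2pi x l : cos (x + l%:~R * (2 * pi)) = cos x.
Proof.
have -> : l%:~R * (2 * pi) = (l%:~R * pi) *+ 2 :> R by rewrite mulr2n; ring.
rewrite cosD cos_mulr2n sin_mulr2n sin_int_pi sqr_cos_int_pi.
by rewrite mulr0 mul0rn mulr2n; ring.
Qed.

Lemma cos_mulSS i x :
  cos (i.+2%:R * x) = 2 * cos x * cos (i.+1%:R * x) - cos (i%:R * x).
Proof.
have -> : i.+2%:R * x = i.+1%:R * x + x by rewrite -[in LHS]natr1; ring.
have -> : i%:R * x = i.+1%:R * x - x by rewrite -[in RHS]natr1; ring.
by rewrite cosD cosB; ring.
Qed.

(** The recurrence [cos_mulSS] makes cos(ia) a polynomial in cos a; carrying two consecutive indices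
    closes the induction. This is what lets [cheb], defined through [acos], be evaluated at the
    cosine of an arbitrary angle. *)
Lemma eq_cos_mul i a b : cos a = cos b -> cos (i%:R * a) = cos (i%:R * b).
Proof.
move=> ab; suff [] : cos (i%:R * a) = cos (i%:R * b) /\
  cos (i.+1%:R * a) = cos (i.+1%:R * b) by [].
elim: i => [|i [IH1 IH2]]; first by rewrite !mul0r !mul1r.
by split=> //; rewrite !cos_mulSS IH1 IH2 ab.
Qed.

Lemma cheb_cos i x : cheb i (cos x) = cos (i%:R * x).
Proof. by apply: eq_cos_mul; rewrite acosK// in_itv/= cos_geN1 cos_le1. Qed.

Lemma cheb_sin i x : cheb i (sin x) = cos (i%:R * (x - pi / 2)).
Proof. by rewrite -cosBpihalf cheb_cos. Qed.

Lemma cheb_mul i j x :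
  cheb i x * cheb j x = (cheb (i + j) x + cheb `|i - j|%N x) / 2.
Proof.
rewrite /cheb cos_mul_cos natrD -mulrDl -mulrBl; congr ((_ + _) / _).
have [ij|/ltnW ij] := leqP j i; first by rewrite distnEl// natrB.
by rewrite distnEr// natrB// -cosN -mulNr opprB.
Qed.

End Trigonometry.

(** * The index set as lattice points of a triangle *)

Section IndexSet.
Variables n p : nat.
Local Notation q := (n + p)%N.
Hypotheses (n_gt0 : (0 < n)%N) (p_gt0 : (0 < p)%N).

(** On the layer i + j = 2n + m one has n i + q j = n(2n + m) + p j, so the layer condition says
    that the point lies strictly below the line n i + q j = 2nq. The triangle i + j <= 2n also lies
    strictly below that line, except for its vertex (0, 2n), which is on it. *)
Lemma GammaLE i j :
  GammaL n p i j = (n * i + q * j < 2 * n * q)%N || (i == 0%N) && (j == (2 * n)%N).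
Proof.
apply/idP/idP.
- case/orP => [ij|/existsP[m /and3P[m_gt0 /eqP ijm jm]]]; last first.
    apply/orP; left; nia.
  case: (eqVneq i 0%N) => [i0|i0]; case: (eqVneq j (2 * n)%N) => [j0|j0];
    rewrite ?orbT//= ?orbF; nia.
- case/orP => [ij|/andP[/eqP-> /eqP->]]; last by rewrite /GammaL add0n leqnn.
  rewrite /GammaL; have [//|ij2] := leqP (i + j) (2 * n); apply/orP; right.
  have ltm : (i + j - 2 * n < 2 * p)%N by nia.
  apply/existsP; exists (Ordinal ltm) => /=; apply/and3P; split.
  + by rewrite subn_gt0.
  + by rewrite subnKC// ltnW.
  + nia.
Qed.

Lemma GammaL_ltl i j : GammaL n p i j -> (i < 2 * n + 2 * p)%N.
Proof. by rewrite GammaLE => /orP[?|/andP[/eqP-> _]]; nia. Qed.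

Lemma GammaL_ltr i j : GammaL n p i j -> (j < 2 * n + 2 * p)%N.
Proof. by rewrite GammaLE => /orP[?|/andP[_ /eqP->]]; nia. Qed.

End IndexSet.

(** * The angles A and B at the nodes and the two parity classes of nodes *)

Section Nodes.
Variables (R : realType) (n p : nat).
Local Notation q := (n + p)%N.
Hypotheses (n_gt0 : (0 < n)%N) (p_gt0 : (0 < p)%N).

Let nR_neq0 : n%:R != 0 :> R.
Proof. by rewrite pnatr_eq0 -lt0n. Qed.

Let qR_neq0 : q%:R != 0 :> R.
Proof. by rewrite pnatr_eq0 -lt0n addn_gt0 n_gt0. Qed.

(* The angles A, B of the header: gamma t = (cos (angx t), cos (angy t)). *)
Definition angx (t : R) : R := n%:R * t - pi / 2.
Definition angy (t : R) : R := q%:R * t - pi / 2.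

Local Notation A k := (angx (tk R n p k)).
Local Notation B k := (angy (tk R n p k)).

Lemma cheb_gamma i j t :
  cheb i (gamma n p t).1 * cheb j (gamma n p t).2 =
  cos (i%:R * angx t) * cos (j%:R * angy t).
Proof. by rewrite !cheb_sin. Qed.

(** At the nodes A is a multiple of pi/(2q), and B one of pi/(2n); hence the frequencies of A are
    periodic modulo 4q and those of B modulo 4n. *)
Lemma angx_tk (k : int) : 2 * q%:R * A k = (k - q%:Z)%:~R * pi.
Proof.
rewrite /angx /tk !natrM intrB -!pmulrn; field.
by rewrite -?natrD ?nR_neq0 ?qR_neq0.
Qed.

Lemma angy_tk (k : int) : 2 * n%:R * B k = (k - n%:Z)%:~R * pi.
Proof.
rewrite /angy /tk !natrM intrB -!pmulrn; field.
by rewrite -?natrD ?nR_neq0 ?qR_neq0.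
Qed.

Lemma cos_angx_period (i j d k : int) : i = j + 4 * q%:Z * d ->
  cos (i%:~R * A k) = cos (j%:~R * A k).
Proof.
move=> ->; rewrite -(cosD_int_2pi (j%:~R * A k) (d * (k - q%:Z))).
congr cos; rewrite rmorphD/= mulrDl; congr (_ + _).
have := angx_tk k; rewrite !rmorphM/= => E.
transitivity (2 * d%:~R * (2 * q%:R * A k)); last by rewrite E; ring.
by rewrite -pmulrn; ring.
Qed.

Lemma cos_angy_period (i j d k : int) : i = j + 4 * n%:Z * d ->
  cos (i%:~R * B k) = cos (j%:~R * B k).
Proof.
move=> ->; rewrite -(cosD_int_2pi (j%:~R * B k) (d * (k - n%:Z))).
congr cos; rewrite rmorphD/= mulrDl; congr (_ + _).
have := angy_tk k; rewrite !rmorphM/= => E.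
transitivity (2 * d%:~R * (2 * n%:R * B k)); last by rewrite E; ring.
by rewrite -pmulrn; ring.
Qed.

Hypothesis p_odd : odd p.

(** This is sin(p pi/2) = (-1)^((p-1)/2) for odd p. *)
Definition sgn_p : R := cos ((p./2)%:R * pi).

Let half_p : p%:R = 1 + 2 * (p./2)%:R :> R.
Proof. by rewrite -[in LHS](odd_double_half p) p_odd -muln2 natrD natrM mulrC. Qed.

Lemma cos_p_pi2 x : sin (x * pi) = 0 ->
  [/\ cos (x * pi + p%:R * (pi / 2)) = 0 &
      sin (x * pi + p%:R * (pi / 2)) = sgn_p * cos (x * pi)].
Proof.
move=> sx.
have -> : x * pi + p%:R * (pi / 2) = x * pi + (p./2)%:R * pi + pi / 2.
  by rewrite half_p; field.
have s0 : sin ((p./2)%:R * pi) = 0 :> R by rewrite pmulrn sin_int_pi.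
by rewrite cosDpihalf sinDpihalf sinD cosD sx s0 /sgn_p; split; ring.
Qed.

(** Since p is odd, exactly one of k - n and k - q is even. In either class one of qA, nB is a
    multiple of pi and the other an odd multiple of pi/2; the last equation of each constructor
    records the sign that survives. *)
Variant node_spec (k : int) : Prop :=
| NodeX l of k = n%:Z + 2 * l & cos (q%:R * A k) = 0 & sin (n%:R * B k) = 0
    & sin (q%:R * A k) * cos (n%:R * B k) = - sgn_p
| NodeY l of k = q%:Z + 2 * l & sin (q%:R * A k) = 0 & cos (n%:R * B k) = 0
    & cos (q%:R * A k) * sin (n%:R * B k) = sgn_p.

Lemma nodeP k : node_spec k.
Proof.
have [l [kl|kl]] : exists l, k = n%:Z + 2 * l \/ k = q%:Z + 2 * l.
  have := divz_eq (k - n%:Z) 2; have := modz_ge0 (k - n%:Z) (isT : 2 != 0 :> int).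
  have := ltz_pmod (k - n%:Z) (isT : 0 < 2 :> int).
  set d := (_ %/ _)%Z; set r := (_ %% _)%Z => r2 r0 kr.
  have [r0'|r1] : r = 0 \/ r = 1 by lia.
    by exists d; left; lia.
  (* Here k = n + 1 + 2d, and 1 = p - 2 (p-1)/2 turns n + 1 into q plus an even number. *)
  by exists (d - (p./2)%:Z); right; move: (odd_double_half p); rewrite p_odd; lia.
- have EA : q%:R * A k = - (((-l)%:~R : R) * pi + p%:R * (pi / 2)).
    have : q%:R * A k = (2 * q%:R * A k) / 2 by field.
    rewrite angx_tk kl => ->; rewrite !rmorphB rmorphD rmorphM/= -!pmulrn rmorphN/= natrD.
    by field.
  have EB : n%:R * B k = (l%:~R : R) * pi.
    have : n%:R * B k = (2 * n%:R * B k) / 2 by field.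
    rewrite angy_tk kl => ->; rewrite !rmorphB rmorphD rmorphM/= -!pmulrn.
    by field.
  have [c0 s0] := cos_p_pi2 (sin_int_pi R (-l)).
  apply: (NodeX kl); rewrite ?EA ?EB ?cosN ?sinN ?c0 ?s0 ?sin_int_pi//.
  have -> : cos ((- l)%:~R * pi) = cos (l%:~R * pi) :> R.
    by rewrite intrN mulNr cosN.
  by rewrite mulNr -mulrA -expr2 sqr_cos_int_pi mulr1.
- have EB : n%:R * B k = (l%:~R : R) * pi + p%:R * (pi / 2).
    have : n%:R * B k = (2 * n%:R * B k) / 2 by field.
    rewrite angy_tk kl => ->; rewrite !rmorphB rmorphD rmorphM/= -!pmulrn natrD.
    by field.
  have EA : q%:R * A k = (l%:~R : R) * pi.
    have : q%:R * A k = (2 * q%:R * A k) / 2 by field.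
    rewrite angx_tk kl => ->; rewrite !rmorphB rmorphD rmorphM/= -!pmulrn.
    by field.
  have [c0 s0] := cos_p_pi2 (sin_int_pi R l).
  apply: (NodeY kl); rewrite ?EA ?EB ?c0 ?s0 ?sin_int_pi//.
  by rewrite mulrCA -expr2 sqr_cos_int_pi mulr1.
Qed.

(* The rotation by pi of the index triangle about the midpoint of its
   hypotenuse is a symmetry, up to sign, at the nodes. *)
Lemma cos_cos_node_reflect (i j k : int) :
  cos ((2 * q%:Z - i)%:~R * A k) * cos ((2 * n%:Z - j)%:~R * B k) =
  - (cos (i%:~R * A k) * cos (j%:~R * B k)).
Proof.
have -> : (2 * q%:Z - i)%:~R * A k = (q%:R * A k) *+ 2 - i%:~R * A k.
  by rewrite intrB intrM -pmulrn mulr2n; ring.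
have -> : (2 * n%:Z - j)%:~R * B k = (n%:R * B k) *+ 2 - j%:~R * B k.
  by rewrite intrB intrM -pmulrn mulr2n; ring.
rewrite !cosB !sin_mulr2n !cos_mulr2n.
case: (nodeP k) => l _ c0 s0 sc; rewrite !c0 !s0.
  have : cos (n%:R * B k) ^+ 2 = 1 by rewrite cos2sin2 s0 expr0n subr0.
  by move=> ->; rewrite !mulr2n; ring.
have : cos (q%:R * A k) ^+ 2 = 1 by rewrite cos2sin2 c0 expr0n subr0.
by move=> ->; rewrite !mulr2n; ring.
Qed.

(** As cos(qA) = 0 and sin(nB) = 0, the cosines of (q-i)A and (n+j)B collapse to sin(qA) sin(iA) and
    cos(nB) cos(jB), and the factor sin(qA) cos(nB) is a sign. [cos_sin_node] reaches the same
    right-hand side on the other class, so one formula will serve all nodes. *)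
Lemma sin_cos_node (i j k l : int) : k = n%:Z + 2 * l ->
  sin (i%:~R * A k) * cos (j%:~R * B k) =
  - sgn_p * (cos ((q%:Z - i)%:~R * A k) * cos ((n%:Z + j)%:~R * B k)).
Proof.
move=> kl; case: (nodeP k) => l' kl' c0 s0 sc; last first.
  by exfalso; move: (odd_double_half p); rewrite p_odd; lia.
have -> : (q%:Z - i)%:~R * A k = q%:R * A k - i%:~R * A k.
  by rewrite intrB -pmulrn; ring.
have -> : (n%:Z + j)%:~R * B k = n%:R * B k + j%:~R * B k.
  by rewrite intrD -pmulrn; ring.
rewrite cosB cosD c0 s0 -sc.
have : cos (n%:R * B k) ^+ 2 = 1 by rewrite cos2sin2 s0 expr0n subr0.
have : sin (q%:R * A k) ^+ 2 = 1 by rewrite sin2cos2 c0 expr0n subr0.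
set x := sin _; set y := cos _ => x2 y2.
transitivity (x ^+ 2 * y ^+ 2 * (sin (i%:~R * A k) * cos (j%:~R * B k))).
  by rewrite x2 y2; ring.
by ring.
Qed.

Lemma cos_sin_node (i j k l : int) : k = q%:Z + 2 * l ->
  cos (i%:~R * A k) * sin (j%:~R * B k) =
  - sgn_p * (cos ((q%:Z - i)%:~R * A k) * cos ((n%:Z + j)%:~R * B k)).
Proof.
move=> kl; case: (nodeP k) => l' kl' c0 s0 sc.
  by exfalso; move: (odd_double_half p); rewrite p_odd; lia.
have -> : (q%:Z - i)%:~R * A k = q%:R * A k - i%:~R * A k.
  by rewrite intrB -pmulrn; ring.
have -> : (n%:Z + j)%:~R * B k = n%:R * B k + j%:~R * B k.
  by rewrite intrD -pmulrn; ring.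
rewrite cosB cosD c0 s0 -sc.
have : cos (q%:R * A k) ^+ 2 = 1 by rewrite cos2sin2 c0 expr0n subr0.
have : sin (n%:R * B k) ^+ 2 = 1 by rewrite sin2cos2 s0 expr0n subr0.
set x := cos _; set y := sin _ => y2 x2.
transitivity (x ^+ 2 * y ^+ 2 * (cos (i%:~R * A k) * sin (j%:~R * B k))).
  by rewrite x2 y2; ring.
by ring.
Qed.

End Nodes.

(** * Node sequences that are traces of elements of Pi^L *)

Section Representable.
Variables (R : realType) (n p : nat).
Local Notation q := (n + p)%N.
Hypotheses (n_gt0 : (0 < n)%N) (p_gt0 : (0 < p)%N).

Lemma PiL_lin (a b : R) f g : PiL n p f -> PiL n p g ->
  PiL n p (fun x y => a * f x y + b * g x y).
Proof.
move=> [c fc] [d gd]; exists (fun i j => a * c i j + b * d i j) => x y.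
rewrite fc gd !mulr_sumr -big_split/=; apply: eq_bigr => i _.
rewrite !mulr_sumr -big_split/=; apply: eq_bigr => j _.
by case: ifP => _; ring.
Qed.

Lemma PiL0 : PiL n p (fun _ _ => 0 : R).
Proof.
exists (fun _ _ => 0) => x y; rewrite big1// => i _; rewrite big1// => j _.
by case: ifP => _; ring.
Qed.

Lemma PiL_cheb i j : GammaL n p i j -> PiL n p (fun x y : R => cheb i x * cheb j y).
Proof.
move=> ij; exists (fun k l => ((k == i) && (l == j))%:R) => x y.
have ilt := GammaL_ltl n_gt0 p_gt0 ij; have jlt := GammaL_ltr n_gt0 p_gt0 ij.
rewrite (bigD1 (Ordinal ilt))//= (bigD1 (Ordinal jlt))//= ij !eqxx mul1r.
rewrite big1 ?addr0 => [|l /negbTE lj]; last first.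
  by rewrite -val_eqE/= in lj; rewrite lj ?andbF mulr0n !mul0r if_same.
rewrite big1 ?addr0// => k /negbTE ki; rewrite big1// => l _.
by rewrite -val_eqE/= in ki; rewrite ki/= !mul0r if_same.
Qed.

(** Only values at the nodes are compared here; equality of functions is recovered later from
    unisolvence. *)
Definition nodal (g : int -> R) : Prop :=
  exists2 P, PiL n p P & forall k, g k = Egamma n p P (tk R n p k).

Lemma nodal_ext g h : g =1 h -> nodal g -> nodal h.
Proof. by move=> gh [P PL gP]; exists P => // k; rewrite -gh. Qed.

Lemma nodal_lin (a b : R) g h : nodal g -> nodal h ->
  nodal (fun k => a * g k + b * h k).
Proof.
move=> [P PL gP] [Q QL hQ]; exists (fun x y => a * P x y + b * Q x y).
  exact: PiL_lin.
by move=> k; rewrite gP hQ.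
Qed.

Lemma nodal0 : nodal (fun=> 0).
Proof. by exists (fun _ _ => 0); first exact: PiL0. Qed.

Lemma nodalZ (a : R) g : nodal g -> nodal (fun k => a * g k).
Proof.
move=> gN; apply: (nodal_ext _ (nodal_lin a 0 gN nodal0)) => k /=.
by rewrite mulr0 addr0.
Qed.

Lemma nodal_sum I (s : seq I) (F : I -> int -> R) :
  (forall i, nodal (F i)) -> nodal (fun k => \sum_(i <- s) F i k).
Proof.
move=> FN; elim: s => [|i s IH].
  by apply: (nodal_ext _ nodal0) => k; rewrite big_nil.
apply: (nodal_ext _ (nodal_lin 1 1 (FN i) IH)) => k.
by rewrite big_cons !mul1r.
Qed.

Hypothesis p_odd : odd p.
Hypothesis nq_coprime : coprime n q.

Local Notation A k := (angx n (tk R n p k)).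
Local Notation B k := (angy n p (tk R n p k)).
Local Notation C i j := (fun k => cos (i%:~R * A k) * cos (j%:~R * B k)).

Lemma nodal_GammaL (i j : nat) : GammaL n p i j -> nodal (C i%:Z j%:Z).
Proof.
move=> ij; exists (fun x y => cheb i x * cheb j y); first exact: PiL_cheb.
by move=> k; rewrite /Egamma cheb_gamma -!pmulrn.
Qed.

(** Either (i,j) or its reflection (2q-i, 2n-j) is in the index set, or both miss it and lie on the
    line n i + q j = 2nq. Coprimality leaves only (0,2n), (q,n) and (2q,0) on that line: the first
    belongs to the set and the third reflects to it. *)
Lemma nodal_rect (i j : nat) : (i <= 2 * q)%N -> (j <= 2 * n)%N ->
  nodal (C i%:Z j%:Z).
Proof.
move=> iq jn.
have reflect : nodal (C (2 * q - i)%N%:Z (2 * n - j)%N%:Z) -> nodal (C i%:Z j%:Z).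
  move/(nodalZ (-1)); apply: nodal_ext => k.
  rewrite -!subzn//= !PoszM cos_cos_node_reflect//; ring.
have [|] := boolP (GammaL n p i j); first exact: nodal_GammaL.
rewrite GammaLE// negb_or -leqNgt => /andP[le_nq ij0].
have [|] := boolP (GammaL n p (2 * q - i) (2 * n - j)).
  by move=> /nodal_GammaL; exact: reflect.
rewrite GammaLE// negb_or -leqNgt => /andP[le_nq' ij0'].
have eq_nq : (n * i + q * j = 2 * n * q)%N.
    move: le_nq le_nq'; rewrite !mulnBr.
    have := leq_mul (leqnn n) iq; have := leq_mul (leqnn q) jn; lia.
have : (q %| i)%N.
  have : (q %| n * i + q * j)%N by rewrite eq_nq dvdn_mull.
  by rewrite (dvdn_addl _ (dvdn_mulr j (dvdnn q))) Gauss_dvdr// coprime_sym.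
have q_gt0 : (0 < q)%N by rewrite addn_gt0 n_gt0.
case/dvdnP => d iE; have dle2 : (d <= 2)%N by rewrite -(leq_pmul2r q_gt0) -iE.
have jE : (j + n * d = 2 * n)%N.
  by apply/eqP; rewrite -(eqn_pmul2l q_gt0); apply/eqP; move: eq_nq; rewrite iE; lia.
case: d dle2 iE jE => [|[|[|//]]] _ iE jE.
- by move: ij0; rewrite iE mul0n/= -jE muln0 addn0 eqxx.
(* The point (q,n) is fixed by the reflection, so its function equals its own negative at every node
   and vanishes there. *)
- apply: (nodal_ext _ nodal0) => k; have := cos_cos_node_reflect R n_gt0 p_gt0 p_odd i%:Z j%:Z k.
  have -> : 2 * q%:Z - i%:Z = i%:Z by lia.
  have -> : 2 * n%:Z - j%:Z = j%:Z by lia.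
  lra.
- by move: ij0'; rewrite iE mulnC subnn/=; case: eqP => //; lia.
Qed.

(** Reduction modulo 4m, then a sign change if the remainder exceeds 2m; it is used with m = q for A
    and m = n for B. *)
Lemma fold_angle (m : nat) (i : int) : (0 < m)%N ->
  exists j : nat, (j <= 2 * m)%N /\
  exists d : int, i = j%:Z + 4 * m%:Z * d \/ i = - j%:Z + 4 * m%:Z * d.
Proof.
move=> m_gt0.
have := divz_eq i (4 * m%:Z); have := modz_ge0 i (_ : 4 * m%:Z != 0).
have := ltz_pmod i (_ : 0 < 4 * m%:Z).
set d := (_ %/ _)%Z; set r := (_ %% _)%Z => r2 r0 ir.
have {}r2 : r < 4 * m%:Z by apply: r2; lia.
have {}r0 : 0 <= r by apply: r0; lia.
have [rm|rm] := lerP r (2 * m%:Z).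
  by exists (absz r); split; [lia | exists d; left; lia].
by exists (absz (4 * m%:Z - r)%R); split; [lia | exists (d + 1); right; lia].
Qed.

Lemma nodal_cos_cos (i j : int) : nodal (C i j).
Proof.
have [i' [i'q [d iE]]] := fold_angle i (ltn_addr p n_gt0).
have [j' [j'n [e jE]]] := fold_angle j n_gt0.
apply: (nodal_ext _ (nodal_rect i'q j'n)) => k; congr (_ * _).
  case: iE => /(cos_angx_period R n_gt0 k) ->//.
  by rewrite intrN mulNr cosN.
case: jE => /(cos_angy_period R p n_gt0 k) ->//.
by rewrite intrN mulNr cosN.
Qed.

End Representable.

(** * Mirror nodes and averaging over them *)

Section Symmetrization.
Variables (R : realType) (n p : nat).
Local Notation q := (n + p)%N.
Hypotheses (n_gt0 : (0 < n)%N) (p_gt0 : (0 < p)%N) (p_odd : odd p).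
Hypothesis nq_coprime : coprime n q.
Local Notation A k := (@angx R n (tk R n p k)).
Local Notation B k := (@angy R n p (tk R n p k)).

Let nR_neq0 : n%:R != 0 :> R.
Proof. by rewrite pnatr_eq0 -lt0n. Qed.

Let qR_neq0 : q%:R != 0 :> R.
Proof. by rewrite pnatr_eq0 -lt0n addn_gt0 n_gt0. Qed.

Lemma gammaE t : gamma n p t = (cos (@angx R n t), cos (@angy R n p t)).
Proof. by rewrite /gamma /angx /angy !cosBpihalf. Qed.

Lemma Bezout_nq : exists alpha beta : int, alpha * n%:Z + beta * q%:Z = 1.
Proof.
have /coprimezP[[u v] uv] : coprimez n q by rewrite coprimezE.
by exists u, v.
Qed.

Lemma mirrorX (k l : int) : k = n%:Z + 2 * l -> exists k' d e : int,
  A k' = A k + d%:~R * (2 * pi) /\ B k' = - B k + e%:~R * (2 * pi).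
Proof.
move=> kl; have [alpha [beta E]] := Bezout_nq.
have ER : alpha%:~R * n%:R + beta%:~R * q%:R = 1 :> R.
  by rewrite (pmulrn 1 n) (pmulrn 1 q) -!intrM -intrD E.
(* Subtracting 4qs from k keeps A modulo 2 pi. B is negated modulo 2 pi when k + k' = 2n modulo 4n,
   that is when q s = l modulo n; the Bezout relation gives s = [beta * l]. *)
exists (k - 4 * q%:Z * beta * l), (- beta * l), (alpha * l).
split.
- rewrite /angx /tk !rmorphB !rmorphM rmorphN/= -!pmulrn !natrM; field.
  by rewrite -?natrD ?nR_neq0 ?qR_neq0.
- suff : n%:R * B (k - 4 * q%:Z * beta * l) =
         n%:R * (- B k + (alpha * l)%:~R * (2 * pi)) by move/(mulfI nR_neq0).
  have -> : n%:R * (- B k + (alpha * l)%:~R * (2 * pi)) =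
      - (2 * n%:R * B k) + n%:R * B k + l%:~R * (2 * pi) * (1 - beta%:~R * q%:R).
    by rewrite -[X in X - _]ER addrC intrM; ring.
  rewrite angy_tk// kl /angy /tk !rmorphB !rmorphD !rmorphM/= -!pmulrn !natrM.
  by field; rewrite -?natrD ?nR_neq0 ?qR_neq0.
Qed.

Lemma mirrorY (k l : int) : k = q%:Z + 2 * l -> exists k' d e : int,
  A k' = - A k + d%:~R * (2 * pi) /\ B k' = B k + e%:~R * (2 * pi).
Proof.
move=> kl; have [alpha [beta E]] := Bezout_nq.
have ER : alpha%:~R * n%:R + beta%:~R * q%:R = 1 :> R.
  by rewrite (pmulrn 1 n) (pmulrn 1 q) -!intrM -intrD E.
(* Symmetrically, subtracting 4ns keeps B, and A is negated when n s = l modulo q, solved by s =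
   [alpha * l]. *)
exists (k - 4 * n%:Z * alpha * l), (beta * l), (- alpha * l).
split.
- suff : q%:R * A (k - 4 * n%:Z * alpha * l) =
         q%:R * (- A k + (beta * l)%:~R * (2 * pi)) by move/(mulfI qR_neq0).
  have -> : q%:R * (- A k + (beta * l)%:~R * (2 * pi)) =
      - (2 * q%:R * A k) + q%:R * A k + l%:~R * (2 * pi) * (1 - alpha%:~R * n%:R).
    by rewrite -[X in X - _]ER addrC intrM; ring.
  rewrite angx_tk// kl /angx /tk !rmorphB !rmorphD !rmorphM/= -!pmulrn !natrM.
  by field; rewrite -?natrD ?nR_neq0 ?qR_neq0.
- rewrite /angy /tk !rmorphB !rmorphM rmorphN/= -!pmulrn !natrM; field.
  by rewrite -?natrD ?nR_neq0 ?qR_neq0.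
Qed.

(** Adding the two cosines cancels the terms odd in the negated angle; the remaining mixed term is
    rewritten by [sin_cos_node] or [cos_sin_node]. The result does not depend on the class of k, and
    the phase [psi] covers cosines and sines together. *)
Lemma mirror (k : int) : exists k' : int,
  gamma n p (tk R n p k) = gamma n p (tk R n p k') /\
  forall (i j : int) (psi : R),
    cos (i%:~R * A k + j%:~R * B k + psi) + cos (i%:~R * A k' + j%:~R * B k' + psi)
    = 2 * (cos psi * (cos (i%:~R * A k) * cos (j%:~R * B k)) +
           sgn_p R p * sin psi *
           (cos ((q%:Z - i)%:~R * A k) * cos ((n%:Z + j)%:~R * B k))).
Proof.
case: (nodeP R n_gt0 p_gt0 p_odd k) => l kl _ _ _.
- have [k' [d [e [Ak Bk]]]] := mirrorX kl.
  exists k'; split=> [|i j psi].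
    by rewrite !gammaE Ak Bk !cosD_int_2pi cosN.
  have -> : i%:~R * A k' + j%:~R * B k' + psi =
     (i%:~R * A k - j%:~R * B k + psi) + (i * d + j * e)%:~R * (2 * pi).
    by rewrite Ak Bk intrD !intrM; ring.
  rewrite cosD_int_2pi.
  have := sin_cos_node R n_gt0 p_gt0 p_odd i j kl; rewrite mulNr => E.
  rewrite -mulrA (mulrCA (sgn_p R p)) -(opprK (sgn_p R p * _)) -E !cosD !sinD cosN sinN; ring.
- have [k' [d [e [Ak Bk]]]] := mirrorY kl.
  exists k'; split=> [|i j psi].
    by rewrite !gammaE Ak Bk !cosD_int_2pi cosN.
  have -> : i%:~R * A k' + j%:~R * B k' + psi =
     (- (i%:~R * A k) + j%:~R * B k + psi) + (i * d + j * e)%:~R * (2 * pi).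
    by rewrite Ak Bk intrD !intrM; ring.
  rewrite cosD_int_2pi.
  have := cos_sin_node R n_gt0 p_gt0 p_odd i j kl; rewrite mulNr => E.
  rewrite -mulrA (mulrCA (sgn_p R p)) -(opprK (sgn_p R p * _)) -E !cosD !sinD cosN sinN; ring.
Qed.

Lemma nodal_PiTrigL f : PiTrigL n p f -> nodal n p (fun k => f (tk R n p k)).
Proof.
move=> [[a [b fE]] fL]; have [alpha [beta E]] := Bezout_nq.
(* Since [alpha * n + beta * q = 1], m t equals m alpha A + m beta B up to the constant m (alpha +
   beta) pi/2 coming from the shifts in A and B; [psi] absorbs it. *)
pose psi (m : nat) phi : R := phi + (m%:Z * (alpha + beta))%:~R * (pi / 2).
pose G m phi (k : int) : R := cos (psi m phi) *
    (cos ((m%:Z * alpha)%:~R * A k) * cos ((m%:Z * beta)%:~R * B k)) +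
  sgn_p R p * sin (psi m phi) *
    (cos ((q%:Z - m%:Z * alpha)%:~R * A k) * cos ((n%:Z + m%:Z * beta)%:~R * B k)).
have GN m phi : nodal n p (G m phi) by apply: nodal_lin; exact: nodal_cos_cos.
have angE m phi k : m%:R * tk R n p k + phi = (m%:Z * alpha)%:~R * A k
     + (m%:Z * beta)%:~R * B k + psi m phi.
  have ER : alpha%:~R * n%:R + beta%:~R * q%:R = 1 :> R.
    by rewrite (pmulrn 1 n) (pmulrn 1 q) -!intrM -intrD E.
  rewrite /psi /angx /angy !rmorphM rmorphD/= -!pmulrn.
  transitivity ((alpha%:~R * n%:R + beta%:~R * q%:R) * (m%:R * tk R n p k) + phi).
    by rewrite ER mul1r.
  by field.
have symE k k' : (forall (i j : int) (psi : R),
    cos (i%:~R * A k + j%:~R * B k + psi) + cos (i%:~R * A k' + j%:~R * B k' + psi)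
    = 2 * (cos psi * (cos (i%:~R * A k) * cos (j%:~R * B k)) +
           sgn_p R p * sin psi *
           (cos ((q%:Z - i)%:~R * A k) * cos ((n%:Z + j)%:~R * B k)))) ->
  forall m phi, cos (m%:R * tk R n p k + phi) + cos (m%:R * tk R n p k' + phi) =
    2 * G m phi k.
  by move=> H m phi; rewrite !angE H.
pose N := (2 * n * q)%N.
(* Phase 0 gives the cosine terms of f, phase -pi/2 the sine terms. *)
apply: (@nodal_ext _ _ _ (fun k => 1 * (\sum_(m < N.+1) a m * G m 0 k) +
    1 * \sum_(m <- index_iota 1 N) b m * G m (- (pi / 2)) k)).
  move=> k; have [k' [gk sk]] := mirror k.
  have -> : f (tk R n p k) = (f (tk R n p k) + f (tk R n p k')) / 2.
    by rewrite -(fL _ _ gk); field.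
  rewrite !mul1r !fE addrACA -!big_split/= [RHS]mulrDl; apply/esym; congr (_ + _).
    rewrite mulr_suml; apply: eq_bigr => m _.
    by have := symE _ _ sk m 0; rewrite !addr0 -mulrDr => ->; field.
  rewrite mulr_suml; apply: eq_bigr => m _.
  by have := symE _ _ sk m (- (pi / 2)); rewrite !cosBpihalf -mulrDr => ->; field.
have aN : nodal n p (fun k => \sum_(m < N.+1) a m * G m 0 k).
  by apply: nodal_sum => i; exact: nodalZ.
have bN : nodal n p (fun k => \sum_(m <- index_iota 1 N) b m * G m (- (pi / 2)) k).
  by apply: nodal_sum => i; exact: nodalZ.
exact: (nodal_lin 1 1 aN bN).
Qed.

End Symmetrization.

(** * Trigonometric polynomials and discrete orthogonality *)

Section TrigonometricPolynomials.
Variables (R : realType) (N : nat).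

Lemma PiTrig_ext (f g : R -> R) : f =1 g -> PiTrig N f -> PiTrig N g.
Proof. by move=> fg [a [b fE]]; exists a, b => t; rewrite -fg. Qed.

Lemma PiTrig_lin (x y : R) f g : PiTrig N f -> PiTrig N g ->
  PiTrig N (fun t => x * f t + y * g t).
Proof.
move=> [a [b fE]] [c [d gE]].
exists (fun m => x * a m + y * c m), (fun m => x * b m + y * d m) => t.
rewrite fE gE !mulrDr !mulr_sumr addrACA -!big_split/=.
by congr (_ + _); apply: eq_bigr => m _; ring.
Qed.

Lemma PiTrig0 : PiTrig N (fun=> 0 : R).
Proof.
exists (fun=> 0), (fun=> 0) => t.
by rewrite !big1 ?addr0// => m _; rewrite mul0r.
Qed.

Lemma PiTrigZ (x : R) f : PiTrig N f -> PiTrig N (fun t => x * f t).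
Proof.
move=> fN; apply: (PiTrig_ext _ (PiTrig_lin x 0 fN PiTrig0)) => t.
by rewrite mulr0 addr0.
Qed.

Lemma PiTrig_sum I (s : seq I) (F : I -> R -> R) :
  (forall i, PiTrig N (F i)) -> PiTrig N (fun t => \sum_(i <- s) F i t).
Proof.
move=> FN; elim: s => [|i s IH].
  by apply: (PiTrig_ext _ PiTrig0) => t; rewrite big_nil.
apply: (PiTrig_ext _ (PiTrig_lin 1 1 (FN i) IH)) => t.
by rewrite big_cons !mul1r.
Qed.

Lemma PiTrig_cosn (m : nat) : (m <= N)%N -> PiTrig N (fun t : R => cos (m%:R * t)).
Proof.
move=> mN; exists (fun k => (k == m)%:R), (fun=> 0) => t.
rewrite [X in _ + X]big1 ?addr0 => [|k _]; last by rewrite mul0r.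
rewrite (bigD1 (Ordinal (mN : (m < N.+1)%N)))//= eqxx mul1r big1 ?addr0// => k.
by rewrite -val_eqE/= => /negbTE ->; rewrite mul0r.
Qed.

Lemma PiTrig_sinn (m : nat) : (m < N)%N -> PiTrig N (fun t : R => sin (m%:R * t)).
Proof.
move=> mN; exists (fun=> 0), (fun k => (k == m)%:R) => t.
rewrite big1 ?add0r => [|k _]; last by rewrite mul0r.
have [->|m0] := posnP m.
  by rewrite mul0r sin0 big1_seq// => k /andP[_]; rewrite mem_index_iota;
    case: k => // k _; rewrite mul0r.
rewrite (@big_cat_nat _ _ _ m 1 N)//=; last exact: ltnW.
rewrite big1_seq ?add0r => [|k]; last first.
  by rewrite mem_index_iota => /andP[_ /andP[_ km]]; rewrite ltn_eqF// mul0r.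
rewrite big_ltn// eqxx mul1r big1_seq ?addr0// => k.
by rewrite mem_index_iota => /andP[_ /andP[mk _]]; rewrite gtn_eqF// mul0r.
Qed.

(** The bound is strict because a phase brings in a sine, and the space contains sines only up to
    frequency N - 1. *)
Lemma PiTrig_cos (z : int) (phi : R) : (`|z|%N < N)%N ->
  PiTrig N (fun t => cos (z%:~R * t + phi)).
Proof.
move=> zN; pose e := (-1) ^+ (z < 0)%R : R.
apply: (PiTrig_ext _ (PiTrig_lin (cos phi) (- e * sin phi)
  (PiTrig_cosn (ltnW zN)) (PiTrig_sinn zN))) => t.
have -> : z%:~R * t = e * (`|z|%N%:R * t).
  by rewrite mulrA /e; case: z {zN e} => m /=; rewrite ?mul1r ?mulN1r.
rewrite cosD /e; case: (z < 0); rewrite ?expr1 ?expr0 ?mul1r ?mulN1r ?cosN ?sinN; ring.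
Qed.

Hypothesis N_gt0 : (0 < N)%N.

(** For N = 2n(n+p) these are the points t_k. *)
Definition trig_node (k : nat) : R := pi * k%:R / N%:R.
Local Notation tau := trig_node.

Let NR_neq0 : N%:R != 0 :> R.
Proof. by rewrite pnatr_eq0 -lt0n. Qed.

Lemma sin_half_node_gt0 (l : nat) : (0 < l < 2 * N)%N -> 0 < sin (l%:R * tau 1 / 2).
Proof.
move=> /andP[l0 lN]; apply: sin_gt0_pi.
have -> : l%:R * tau 1 / 2 = pi * (l%:R / (2 * N)%:R).
  by rewrite /trig_node natrM; field; rewrite ?NR_neq0.
have N2 : 0 < (2 * N)%:R :> R by rewrite ltr0n muln_gt0.
apply/andP; split; first by rewrite mulr_gt0 ?pi_gt0// divr_gt0// ltr0n.
by rewrite -[ltRHS]mulr1 ltr_pM2l ?pi_gt0// ltr_pdivrMr// mul1r ltr_nat.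
Qed.

(* Multiplied by 2 sin(h/2), h the increment of the angle, the sum telescopes. *)
Lemma sum_cos_node (l : nat) (phi : R) : (0 < l < 2 * N)%N ->
  \sum_(0 <= k < 2 * N) cos (l%:R * tau k + phi) = 0.
Proof.
move=> l0; have s0 := sin_half_node_gt0 l0.
apply: (mulfI (lt0r_neq0 s0)); apply: (@mulfI _ 2); first by rewrite pnatr_eq0.
rewrite !mulr0 !mulr_sumr.
pose f k := sin (phi + l%:R * tau k - l%:R * tau 1 / 2).
rewrite (eq_bigr (fun k => f k.+1 - f k)) => [|k _].
  rewrite telescope_sumr// /f.
  (* Over all 2N nodes the angle advances by l full turns. *)
  have -> : phi + l%:R * tau (2 * N) - l%:R * tau 1 / 2 =
            phi + l%:R * tau 0 - l%:R * tau 1 / 2 + (pi *+ 2) *+ l.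
    by rewrite /trig_node natrM -mulr_natr -mulr_natr; field; rewrite ?NR_neq0.
  by rewrite (periodicn (@sinD2pi R)) subrr.
have -> : f k.+1 = sin (l%:R * tau k + phi + l%:R * tau 1 / 2).
  by rewrite /f; congr sin; rewrite /trig_node -natr1; field; rewrite ?NR_neq0.
have -> : f k = sin (l%:R * tau k + phi - l%:R * tau 1 / 2).
  by rewrite /f; congr sin; ring.
by rewrite sinD sinB; ring.
Qed.

(** For distinct l, m at most N, both l + m and |l - m| lie strictly between 0 and 2N, so neither
    frequency aliases to 0. *)
Lemma sum_cos_cos_node (l m : nat) (phi psi : R) :
  (l <= N)%N -> (m <= N)%N -> l <> m ->
  \sum_(0 <= k < 2 * N) cos (l%:R * tau k + phi) * cos (m%:R * tau k + psi) = 0.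
Proof.
wlog lm : l m phi psi / (m <= l)%N.
  move=> H lN mN lm; have [ml|/ltnW ml] := leqP m l; first exact: H.
  by under eq_bigr do rewrite mulrC; apply: H => // /esym.
move=> lN mN lm'; under eq_bigr => k _.
  rewrite cos_mul_cos.
  have -> : l%:R * tau k + phi + (m%:R * tau k + psi) = (l + m)%:R * tau k + (phi + psi).
    by rewrite natrD; ring.
  have -> : l%:R * tau k + phi - (m%:R * tau k + psi) = (l - m)%:R * tau k + (phi - psi).
    by rewrite natrB//; ring.
  over.
by rewrite -mulr_suml big_split/= !sum_cos_node ?addr0 ?mul0r//; lia.
Qed.

Lemma sum_sin_cos_node (m : nat) : (0 < m < N)%N ->
  \sum_(0 <= k < 2 * N) sin (m%:R * tau k) * cos (m%:R * tau k) = 0.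
Proof.
move=> m0; under eq_bigr => k _.
  have -> : sin (m%:R * tau k) * cos (m%:R * tau k) =
    cos ((2 * m)%:R * tau k - pi / 2) / 2.
    have -> : (2 * m)%:R * tau k = (m%:R * tau k) *+ 2 by rewrite natrM mulr2n; ring.
    by rewrite cosBpihalf sin_mulr2n mulr2n; field.
  over.
by rewrite -mulr_suml sum_cos_node ?mul0r//; lia.
Qed.

(** Pairing f with one basis function over 2N nodes isolates its coefficient by orthogonality, and
    the factor left over is a sum of squares. That factor is only shown to be nonzero, not
    computed. *)
Lemma PiTrig_unisolvent f :
  PiTrig N f -> (forall k, f (tau k) = 0) -> forall t, f t = 0.
Proof.
move=> [a [b fE]] f0.
have tau0 : tau 0 = 0 by rewrite /trig_node mulr0 mul0r.
have sinE x : sin x = cos (x - pi / 2) :> R by rewrite cosBpihalf.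
have cosE x : cos x = cos (x + 0) :> R by rewrite addr0.
have test (g : nat -> R) : 0 =
    \sum_(i < N.+1) a i * (\sum_(0 <= k < 2 * N) cos (i%:R * tau k) * g k)
    + \sum_(1 <= i < N) b i * (\sum_(0 <= k < 2 * N) sin (i%:R * tau k) * g k).
  transitivity (\sum_(0 <= k < 2 * N) f (tau k) * g k).
    by rewrite big1// => k _; rewrite f0 mul0r.
  under eq_bigr do rewrite fE mulrDl !mulr_suml.
  rewrite big_split/= exchange_big/=; congr (_ + _).
    by apply: eq_bigr => i _; rewrite mulr_sumr; apply: eq_bigr => k _; rewrite mulrA.
  rewrite exchange_big/=.
  by apply: eq_bigr => i _; rewrite mulr_sumr; apply: eq_bigr => k _; rewrite mulrA.
have a0 (m : 'I_N.+1) : a m = 0.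
  have mN : (m <= N)%N by rewrite -ltnS.
  have := test (fun k => cos (m%:R * tau k)).
  rewrite (bigD1 m)//= [X in _ + X + _]big1 ?addr0 => [|i im]; last first.
    under eq_bigr => k _ do rewrite cosE [X in _ * X]cosE.
    have iN : (i <= N)%N by rewrite -ltnS.
    have im' : nat_of_ord i <> m by move/val_inj/eqP; rewrite (negbTE im).
    by rewrite (sum_cos_cos_node 0 0 iN mN im') mulr0.
  rewrite [X in _ + X]big1_seq ?addr0 => [|i]; last first.
    rewrite mem_index_iota => /andP[_ i1N].
    have [im|/eqP im] := eqVneq i m; first by rewrite -im sum_sin_cos_node ?mulr0.
    under eq_bigr => k _ do rewrite sinE [X in _ * X]cosE.
    by rewrite sum_cos_cos_node ?mulr0//; case/andP: i1N => _ /ltnW.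
  move/esym/eqP; rewrite mulf_eq0 => /orP[/eqP//|].
  (* The node 0 already contributes cos(0)^2 = 1. *)
  rewrite big_ltn ?muln_gt0// tau0 mulr0 cos0 mulr1 paddr_eq0 ?ler01//.
    by rewrite oner_eq0.
  by apply: sumr_ge0 => k _; rewrite -expr2 sqr_ge0.
have b0 m : (0 < m < N)%N -> b m = 0.
  move=> m0N; have [m0 mN] := andP m0N.
  have := test (fun k => sin (m%:R * tau k)).
  rewrite big1 ?add0r => [|i _]; last by rewrite a0 mul0r.
  rewrite (bigD1_seq m)/= ?mem_index_iota ?iota_uniq//.
  rewrite [X in _ + X]big1_seq ?addr0 => [|i /andP[/eqP im]]; last first.
    rewrite mem_index_iota => /andP[_ iN].
    under eq_bigr => k _ do rewrite sinE [X in _ * X]sinE.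
    by rewrite sum_cos_cos_node ?mulr0// ltnW.
  move/esym/eqP; rewrite mulf_eq0 => /orP[/eqP//|].
  have N2 : (1 < 2 * N)%N by lia.
  (* The node 0 contributes nothing to a sum of squared sines; the node 1 does, as 0 < m pi/N <
     pi. *)
  rewrite big_ltn ?muln_gt0// tau0 mulr0 sin0 mulr0 add0r big_ltn//.
  rewrite paddr_eq0 -?expr2 ?sqr_ge0//; last first.
    by apply: sumr_ge0 => k _; rewrite -expr2 sqr_ge0.
  rewrite sqrf_eq0 => /andP[/eqP s0 _].
  have : (0 < 2 * m < 2 * N)%N by lia.
  move/sin_half_node_gt0.
  have -> : (2 * m)%:R * tau 1 / 2 = m%:R * tau 1 by rewrite natrM; field.
  by rewrite s0 ltxx.
move=> t; rewrite fE big1 ?add0r => [|m _]; last by rewrite a0 mul0r.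
by rewrite big1_seq// => m; rewrite mem_index_iota => /andP[_ /b0 ->]; rewrite mul0r.
Qed.

End TrigonometricPolynomials.

(** * Traces are trigonometric polynomials, and surjectivity *)

Section Trace.
Variables (R : realType) (n p : nat).
Local Notation q := (n + p)%N.
Hypotheses (n_gt0 : (0 < n)%N) (p_gt0 : (0 < p)%N).

(** Below the line both frequencies n i + q j and n i - q j are smaller than 2nq in absolute value.
    At (0,2n) the frequency is exactly 2nq, but its phase is n pi, so only a cosine appears. *)
Lemma PiTrig_cos_cos i j : GammaL n p i j ->
  PiTrig (2 * n * q) (fun t : R => cos (i%:R * angx n t) * cos (j%:R * angy n p t)).
Proof.
rewrite GammaLE// => /orP[ij|/andP[/eqP-> /eqP->]]; last first.
  apply: (PiTrig_ext _ (PiTrigZ (cos (n%:R * pi)) (PiTrig_cosn R (leqnn _)))) => t.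
  have -> : (2 * n)%:R * angy n p t = (2 * n * q)%:R * t - n%:R * pi.
    by rewrite /angy !natrM; field.
  have s0 : sin (n%:R * pi) = 0 :> R by rewrite pmulrn sin_int_pi.
  by rewrite mul0r cos0 mul1r cosB s0 mulr0 addr0 mulrC.
have H1 := @PiTrig_cos R (2 * n * q) (n%:Z * i%:Z + q%:Z * j%:Z)
  (- ((i%:R + j%:R) * (pi / 2))) ltac:(lia).
have H2 := @PiTrig_cos R (2 * n * q) (n%:Z * i%:Z - q%:Z * j%:Z)
  (- ((i%:R - j%:R) * (pi / 2))) ltac:(lia).
apply: (PiTrig_ext _ (PiTrig_lin (2^-1) (2^-1) H1 H2)) => t.
rewrite cos_mul_cos intrD intrB !intrM -!pmulrn.
rewrite mulrDl [RHS]mulrDl !(mulrC (2^-1)); congr (cos _ / _ + cos _ / _).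
  by rewrite /angx /angy; ring.
by rewrite /angx /angy; ring.
Qed.

Lemma PiTrig_Egamma P : PiL n p P -> PiTrig (2 * n * q) (Egamma (R := R) n p P).
Proof.
move=> [c PE]; apply: (@PiTrig_ext _ _ (fun t => \sum_(i < 2 * n + 2 * p)
  \sum_(j < 2 * n + 2 * p) (if GammaL n p i j then
     c i j * (cos (i%:R * angx n t) * cos (j%:R * angy n p t)) else 0))).
  move=> t; rewrite /Egamma PE; apply: eq_bigr => i _; apply: eq_bigr => j _.
  by rewrite -cheb_gamma mulrA.
apply: PiTrig_sum => i; apply: PiTrig_sum => j.
case: (GammaL n p i j) (@PiTrig_cos_cos i j) => [/(_ isT)|_]; last exact: PiTrig0.
exact: PiTrigZ.
Qed.

Lemma PiTrigL_Egamma P : PiL n p P -> PiTrigL n p (Egamma (R := R) n p P).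
Proof.
by move=> PL; split=> [|k k' kk']; [exact: PiTrig_Egamma | rewrite /Egamma kk'].
Qed.

Lemma PiTrigL_is_trace f : odd p -> coprime n q ->
  PiTrigL n p f -> exists2 P, PiL n p P & Egamma (R := R) n p P = f.
Proof.
move=> p_odd nq fL; have [P PL PE] := nodal_PiTrigL n_gt0 p_gt0 p_odd nq fL.
exists P => //; apply/funext => t; apply/eqP; rewrite -subr_eq0; apply/eqP.
have N_gt0 : (0 < 2 * n * q)%N by rewrite !muln_gt0 addn_gt0 n_gt0.
have := PiTrig_unisolvent N_gt0 (PiTrig_lin 1 (-1) (PiTrig_Egamma PL) fL.1).
have nR0 : n%:R != 0 :> R by rewrite pnatr_eq0 -lt0n.
have qR0 : q%:R != 0 :> R by rewrite pnatr_eq0 -lt0n addn_gt0 n_gt0.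
move=> /(_ _ t); rewrite mul1r mulN1r; apply => k.
have -> : trig_node R (2 * n * q) k = tk R n p k%:Z.
  rewrite /trig_node /tk -pmulrn !natrM; field.
  by rewrite -?natrD ?nR0 ?qR0.
by rewrite PE; ring.
Qed.

End Trace.

(** * Integrals with known values *)

Section IntegralValues.
Context d (T : measurableType d) (R : realType).
Variable mu : {measure set T -> \bar R}.
Implicit Types (D : set T) (g h : T -> R).

(** Integrability travels with the value, so that linear combinations and finite sums need no
    separate side conditions. *)
Definition has_int D h (v : R) : Prop :=
  mu.-integrable D (EFin \o h) /\ (\int[mu]_(x in D) (h x)%:E)%E = v%:E.

Lemma has_int_ext D h g v : measurable D -> {in D, h =1 g} ->
  has_int D h v -> has_int D g v.
Proof.
move=> mD hg [hi hv]; split.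
  by apply: eq_integrable hi => // x xD; rewrite /= hg.
by rewrite -hv; apply: eq_integral => x xD; rewrite hg.
Qed.

Lemma has_int_lin D (a b : R) g h v w :
  has_int D g v -> has_int D h w -> measurable D ->
  has_int D (fun x => a * g x + b * h x) (a * v + b * w).
Proof.
move=> [gi gv] [hi hw] mD.
have ai : mu.-integrable D (fun x => a%:E * (g x)%:E)%E by exact: integrableZl.
have bi : mu.-integrable D (fun x => b%:E * (h x)%:E)%E by exact: integrableZl.
split; first by have := integrableD mD ai bi.
under eq_integral do rewrite EFinD !EFinM.
rewrite integralD// !integralZl//.
by rewrite gv hw EFinD !EFinM.
Qed.

Lemma has_int0 D : measurable D -> has_int D (fun=> 0) 0.
Proof. by move=> mD; split; [exact: integrable0 | exact: integral0]. Qed.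

Lemma has_intZ D (a : R) h v : measurable D ->
  has_int D h v -> has_int D (fun x => a * h x) (a * v).
Proof.
move=> mD hv; have := has_int_lin a 0 hv (has_int0 mD) mD.
rewrite mulr0 addr0 => H; apply: has_int_ext H => // x _ /=.
by rewrite addr0.
Qed.

Lemma has_int_sum D I (s : seq I) (h : I -> T -> R) (v : I -> R) : measurable D ->
  (forall i, has_int D (h i) (v i)) ->
  has_int D (fun x => \sum_(i <- s) h i x) (\sum_(i <- s) v i).
Proof.
move=> mD hv; elim: s => [|i s IH].
  by rewrite big_nil; apply: has_int_ext (has_int0 mD) => // x _; rewrite big_nil.
have := has_int_lin 1 1 (hv i) IH mD; rewrite big_cons !mul1r => H.
by apply: has_int_ext H => // x _ /=; rewrite big_cons !mul1r.
Qed.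

End IntegralValues.

(** * The fundamental theorem of calculus, also with endpoint singularities *)

Section FundamentalTheorem.
Variable R : realType.
Local Notation mu := (@lebesgue_measure R).
Implicit Types f F G H : R -> R.

Lemma has_int_FTC (a b : R) f F : a < b -> continuous f ->
  (forall x : R, is_derive x 1 F (f x)) -> has_int mu `[a, b] f (F b - F a).
Proof.
move=> ab cf dF; have cF : continuous F.
  by move=> x; apply: differentiable_continuous; apply/derivable1_diffP; have [] := dF x.
split.
  by apply: continuous_compact_integrable; [exact: segment_compact | exact: continuous_subspaceT].
rewrite (@continuous_FTC2 _ f F)// ?EFinB//.
- exact: continuous_subspaceT.
- split; first by move=> x _; have [] := dF x.
  + exact/cvg_at_right_filter/cF.
  + exact/cvg_at_left_filter/cF.
- by move=> x _; rewrite derive1E; have [_ ->] := dF x.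
Qed.

(** The integrand may blow up at a and b. The fundamental theorem applies on each [u k, v k]; these
    intervals increase to the open interval, and nonnegativity permits monotone convergence. *)
Lemma has_int_ge0_FTC (a b : R) f F (u v : R^nat) (L : R) :
  (forall k, u k.+1 <= u k) -> (forall k, v k <= v k.+1) ->
  (forall k, [/\ a < u k, u k < v k & v k < b]) ->
  (forall x, a < x < b -> exists k, u k <= x <= v k) ->
  (forall x, 0 <= f x) ->
  (forall x, a < x < b -> {for x, continuous f}) ->
  (forall x : R, a < x < b -> is_derive x 1 F (f x)) ->
  (fun k => F (v k) - F (u k)) @ \oo --> L -> has_int mu `[a, b] f L.
Proof.
move=> du dv uv cover f0 cf dF FL.
have mfo : measurable_fun `]a, b[ f.
  by apply: open_continuous_measurable_fun => // x; rewrite inE/= in_itv/= => /cf.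
have mfc : measurable_fun `[a, b] (EFin \o f).
  apply/measurable_EFinP/measurable_fun_itv_obnd_cbndP.
  exact/measurable_fun_itv_bndo_bndcP.
have sub k x : u k <= x <= v k -> a < x < b.
  have [au _ vb] := uv k => /andP[ux xv].
  by rewrite (lt_le_trans au)// (le_lt_trans xv).
have bigE : \bigcup_k `[u k, v k]%classic = `]a, b[%classic.
  apply/seteqP; split=> x /=.
    by move=> [k _] /=; rewrite !in_itv/= => /sub.
  by rewrite in_itv/= => /cover[k kx]; exists k => //=; rewrite in_itv.
have homo_v : {homo v : m n / (m <= n)%N >-> m <= n}.
  exact/nondecreasing_seqP.
have homo_u : {homo u : m n / (m <= n)%N >-> n <= m}.
  exact/nonincreasing_seqP.
have intk k : (\int[mu]_(x in `[u k, v k]) (f x)%:E)%E = (F (v k) - F (u k))%:E.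
  have [_ uvk _] := uv k; have cF x : u k <= x <= v k -> {for x, continuous F}.
    move=> /sub/dF [? _].
    by apply: differentiable_continuous; exact/derivable1_diffP.
  rewrite (@continuous_FTC2 _ f F)// ?EFinB//.
  - by apply: continuous_in_subspaceT => x; rewrite inE/= in_itv/= => /sub/cf.
  - split.
    + by move=> x; rewrite in_itv/= => /andP[/ltW ux /ltW xv]; have [|] := dF x; rewrite ?(sub k)// ux.
    + by apply/cvg_at_right_filter/cF; rewrite lexx ltW.
    + by apply/cvg_at_left_filter/cF; rewrite lexx ltW.
  - move=> x; rewrite in_itv/= => /andP[/ltW ux /ltW xv]; rewrite derive1E.
    by have [|_ ->] := dF x; rewrite ?(sub k)// ux.
have intL : (\int[mu]_(x in `[a, b]) (f x)%:E)%E = L%:E.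
  rewrite integral_itv_bndoo; last exact/measurable_EFinP.
  rewrite -bigE.
  have cv : (\int[mu]_(x in `[u k, v k]) (f x)%:E)%E @[k --> \oo] -->
      (\int[mu]_(x in \bigcup_k `[u k, v k]%classic) (f x)%:E)%E.
    apply: ge0_nondecreasing_set_cvg_integral.
    - move=> i j ij; apply/subsetPset => x /=; rewrite !in_itv/= => /andP[ux xv].
      by rewrite (le_trans (homo_u _ _ ij) ux) (le_trans xv (homo_v _ _ ij)).
    - by move=> i; exact: measurable_itv.
    - move=> i; apply: measurable_funS mfc => // x /=; rewrite !in_itv/= => /sub.
      by move=> /andP[/ltW-> /ltW->].
    - by move=> i x _; rewrite lee_fin.
  rewrite (funext intk) in cv.
  apply: (cvg_unique _ cv) => //.
  by apply: cvg_EFin => //; exact: nearW.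
split=> //; apply/integrableP; split=> //.
under eq_integral do rewrite gee0_abs ?lee_fin//.
by rewrite intL ltry.
Qed.

End FundamentalTheorem.

(** * Integrals against the Chebyshev weight and of cosines over a period *)

Section ChebyshevWeight.
Variable R : realType.
Local Notation mu := (@lebesgue_measure R).

Definition cheb_weight (x : R) : R := (Num.sqrt (1 - x ^+ 2))^-1.

Lemma continuous_acos_comp (H : R -> R) (x : R) : continuous H -> -1 < x < 1 ->
  {for x, continuous (fun x => H (acos x) * cheb_weight x)}.
Proof.
move=> cH x1; apply: continuousM.
  apply: continuous_comp; [exact: continuous_acos | exact: cH].
apply: continuousV.
  by rewrite gt_eqF// sqrtr_gt0 subr_gt0; case/andP: x1; nra.
apply: continuous_comp; last exact: sqrt_continuous.
apply: continuousB; first exact: cst_continuous.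
exact: exprn_continuous.
Qed.

(* The substitution x = cos theta, read off from the antiderivative
   G (acos x); the increasing intervals are [- cos e, cos e] as e tends to 0. *)
Lemma has_int_acos (G H : R -> R) : (forall x, 0 <= H x) -> continuous H ->
  (forall x : R, is_derive x 1 G (- H x)) ->
  has_int mu `[-1, 1] (fun x => H (acos x) * cheb_weight x) (G 0 - G pi).
Proof.
move=> H0 cH dG.
(* The offset 2 makes [e k] < 1 <= pi/2, so that [e k] < pi - [e k] from the start. *)
pose e (k : nat) : R := k.+2%:R^-1.
have e0 k : 0 < e k by rewrite invr_gt0.
have e1 k : e k < 1 by rewrite invf_lt1// ltr1n.
have pi2 : 2 <= pi :> R by exact: pi_ge2.
have e_in k : e k \in `[0, pi].
  by rewrite in_itv/= ltW//= (le_trans (ltW (e1 k)))// (le_trans _ pi2)// ler1n.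
have e_in' k : pi - e k \in `[0, pi].
  by move: (e_in k); rewrite !in_itv/=; lra.
have dec k : e k.+1 <= e k by rewrite lef_pV2 ?posrE// ler_nat.
have cosle (x y : R) : x \in `[0, pi] -> y \in `[0, pi] -> (cos x <= cos y) = (y <= x).
  by move=> x0 y0; rewrite !leNgt ltr_cos.
have in0 : 0 \in `[0, pi : R] by rewrite in_itv/= lexx pi_ge0.
have inpi : pi \in `[0, pi : R] by rewrite in_itv/= lexx pi_ge0.
apply: (@has_int_ge0_FTC _ _ _ _ (G \o @acos R)
  (fun k => cos (pi - e k)) (fun k => cos (e k))).
- by move=> k; rewrite cosle// lerB//.
- by move=> k; rewrite cosle.
- move=> k; have ek0 := e0 k; have ek1 := e1 k; split.
  + by rewrite -cospi ltr_cos//; lra.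
  + by rewrite ltr_cos//; lra.
  + by rewrite -cos0 ltr_cos.
- move=> x x1; have a0 : 0 < acos x by apply: acos_gt0; move: x1; lra.
  have api : acos x < pi by apply: acos_ltpi; move: x1; lra.
  have [k ke] : exists k, e k <= acos x /\ e k <= pi - acos x.
    pose m := Num.min (acos x) (pi - acos x).
    have m0 : 0 < m by rewrite lt_min a0 subr_gt0.
    exists (Num.truncn m^-1).
    suff : e (Num.truncn m^-1) <= m by rewrite le_min => /andP[].
    rewrite -[X in _ <= X]invrK lef_pV2 ?posrE ?invr_gt0//.
    apply: ltW; apply: (lt_trans (truncnS_gt _)); rewrite ltr_nat.
    exact: leqnn.
  exists k; rewrite -{1 2}[x]acosK ?in_itv/=; last by move: x1; lra.
  have ain : acos x \in `[0, pi] by rewrite in_itv/= !ltW.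
  by rewrite !cosle//; move: ke; lra.
- by move=> x; rewrite mulr_ge0// invr_ge0 sqrtr_ge0.
- by move=> x; exact: continuous_acos_comp.
(* The derivative of [acos] is minus the weight, which cancels the sign in G' = -H. *)
- move=> x x1; have da := is_derive1_acos x1.
  have := is_derive1_comp (dG (acos x)) da.
  by rewrite mulrN mulNr opprK.
- have E k : (G \o @acos R) (cos (e k)) - (G \o @acos R) (cos (pi - e k)) =
     G (e k) - G (pi - e k) by rewrite /= !cosK.
  under eq_fun do rewrite E.
  have cG : continuous G.
    by move=> x; apply: differentiable_continuous; apply/derivable1_diffP; have [] := dG x.
  have ecv : e @ \oo --> (0 : R).
    by have := @cvg_harmonic R; rewrite -(cvg_shiftS (@harmonic R)).
  apply: cvgB; first exact: (cvg_comp _ _ ecv (cG 0)).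
  have picv : (fun k => pi - e k) @ \oo --> (pi - 0 : R).
    by apply: cvgB => //; exact: cvg_cst.
  rewrite subr0 in picv; exact: (cvg_comp _ _ picv (cG pi)).
Qed.

Lemma has_int_cheb (m : nat) :
  has_int mu `[-1, 1] (fun x => cheb m x * cheb_weight x) (pi * (m == 0%N)%:R).
Proof.
have int1 : has_int mu `[-1, 1] (fun x => 1 * cheb_weight x) (- 0 - - pi).
  apply: (@has_int_acos (fun x => - x) (fun=> 1)) => // x.
  exact: cst_continuous.
case: m => [|m].
  rewrite eqxx mulr1; move: int1; rewrite oppr0 sub0r opprK => H.
  by apply: has_int_ext H => // x _; rewrite /cheb mul0r cos0.
(* The substitution asks for a nonnegative integrand, so T_m is written as (1 + T_m) - 1; both parts
   integrate to pi. *)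
have dS (x : R) : is_derive x 1 (fun x => - (m.+1%:R^-1 * sin (m.+1%:R * x)) - x)
   (- (1 + cos (m.+1%:R * x))).
  have d1 : is_derive x 1 (fun x : R => m.+1%:R * x) m.+1%:R.
    have := is_deriveZ (m.+1%:R) (is_derive_id x (1 : R)).
    by rewrite /GRing.scale/= mulr1.
  have d2 := is_derive1_comp (is_derive_sin (m.+1%:R * x)) d1.
  have d3 := is_deriveZ (m.+1%:R^-1) d2.
  have d4 := is_deriveB (is_deriveN d3) (is_derive_id x (1 : R)).
  apply: (is_derive_eq d4).
  by rewrite /GRing.scale/= mulrCA mulVf ?pnatr_eq0// mulr1; ring.
have cS : continuous (fun x : R => 1 + cos (m.+1%:R * x)).
  move=> x; apply: cvgD; first exact: cvg_cst.
  apply: continuous_comp; last exact: continuous_cos.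
  exact: mulrl_continuous.
have S0 (x : R) : 0 <= 1 + cos (m.+1%:R * x) by have := cos_geN1 (m.+1%:R * x); lra.
have := has_int_lin 1 (-1) (has_int_acos S0 cS dS) int1 (measurable_itv _).
rewrite !mulr0 sin0 !mulr0 /=.
have -> : sin (m.+1%:R * pi) = 0 :> R by rewrite pmulrn sin_int_pi.
rewrite (_ : 1 * _ + _ = 0); last by ring.
move=> H; apply: has_int_ext H => //.
by move=> x _; rewrite /cheb; ring.
Qed.

Lemma has_int_cos (z : int) (phi : R) :
  has_int mu `[0, 2 * pi] (fun t => cos (z%:~R * t + phi))
    (2 * pi * ((z == 0)%:R * cos phi)).
Proof.
have pi2 : 0 < 2 * pi :> R by rewrite mulr_gt0 ?pi_gt0.
have [->|z0] := eqVneq z 0.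
  have dF (x : R) : is_derive x 1 (fun x => cos phi * x) (cos phi).
    have := is_deriveZ (cos phi) (is_derive_id x (1 : R)).
    by rewrite /GRing.scale/= mulr1.
  have := has_int_FTC pi2 (@cst_continuous _ _ (cos phi)) dF.
  rewrite mulr0 subr0 => H; rewrite ?eqxx mul1r [X in has_int _ _ _ X]mulrC.
  by apply: has_int_ext H => // x _; rewrite mul0r add0r.
have zR : z%:~R != 0 :> R by rewrite intr_eq0.
have dF (x : R) : is_derive x 1 (fun x => z%:~R^-1 * sin (z%:~R * x + phi))
    (cos (z%:~R * x + phi)).
  have d1 : is_derive x 1 (fun x : R => z%:~R * x + phi) z%:~R.
    have := is_deriveD (is_deriveZ (z%:~R) (is_derive_id x (1 : R))) (is_derive_cst phi x 1).
    by rewrite /GRing.scale/= mulr1 addr0.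
  have d3 := is_deriveZ (z%:~R^-1) (@is_derive1_comp _ sin
    (fun x => z%:~R * x + phi) x _ _ (is_derive_sin _) d1).
  apply: (is_derive_eq d3).
  by rewrite /GRing.scale/= mulrCA mulVf// mulr1.
have cF : continuous (fun x : R => cos (z%:~R * x + phi)).
  move=> x; apply: (@continuous_comp _ _ _ (fun x : R => z%:~R * x + phi) cos);
    last exact: continuous_cos.
  apply: cvgD; last exact: cvg_cst.
  exact: mulrl_continuous.
have := has_int_FTC pi2 cF dF; rewrite mul0r mulr0.
suff -> : sin (z%:~R * (2 * pi) + phi) = sin (0 + phi) by rewrite mulr0 add0r subrr.
by rewrite -!cosBpihalf -addrA addrC cosD_int_2pi add0r.
Qed.

End ChebyshevWeight.

(** * One Gram form for both inner products *)

Section Isometry.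
Variables (R : realType) (n p : nat).
Local Notation q := (n + p)%N.
Hypotheses (n_gt0 : (0 < n)%N) (p_gt0 : (0 < p)%N).
Local Notation mu := (@lebesgue_measure R).
Local Notation m := (2 * n + 2 * p)%N.
Implicit Types c d : nat -> nat -> R.

(** The weighted integral of T_i T_k divided by pi: 1 for i = k = 0, 1/2 for i = k > 0, else 0. It
    is kept in the shape given by the product formula, in which it reappears on the curve. *)
Definition cheb_gram (i k : nat) : R :=
  (((i + k)%N == 0%N)%:R + (`|i - k|%N == 0%N)%:R) / 2.

Lemma cheb_gram_neq i k : i != k -> cheb_gram i k = 0.
Proof.
move=> ik; rewrite /cheb_gram distn_eq0 (negbTE ik).
by case: eqP => [|_]; [lia | rewrite addr0 mul0r].
Qed.

Lemma cheb_gram_gt0 i : 0 < cheb_gram i i.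
Proof. by rewrite /cheb_gram distnn eqxx divr_gt0// ltr_wpDl. Qed.

Definition polyL c (x y : R) : R :=
  \sum_(i < m) \sum_(j < m) c i j * cheb i x * cheb j y.

Definition gramL c d : R :=
  \sum_(i < m) \sum_(j < m) \sum_(k < m) \sum_(l < m)
    c i j * d k l * (cheb_gram i k * cheb_gram j l).

(** The restriction to the index set is moved from the sum into the coefficients, so that products
    expand over full boxes. *)
Definition supportL c := forall i j, ~~ GammaL n p i j -> c i j = 0.

Lemma PiL_polyL f : PiL n p f -> exists2 c, supportL c & f = polyL c.
Proof.
move=> [c fE]; exists (fun i j => if GammaL n p i j then c i j else 0).
  by move=> i j /negbTE ->.
apply/funext => x; apply/funext => y; rewrite fE.
apply: eq_bigr => i _; apply: eq_bigr => j _.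
by case: ifP => // _; rewrite !mul0r.
Qed.

Lemma polyL_mul c d x y : polyL c x y * polyL d x y =
  \sum_(i < m) \sum_(j < m) \sum_(k < m) \sum_(l < m)
    c i j * d k l * (cheb i x * cheb k x * (cheb j y * cheb l y)).
Proof.
rewrite /polyL mulr_suml; apply: eq_bigr => i _.
rewrite mulr_suml; apply: eq_bigr => j _.
rewrite mulr_sumr; apply: eq_bigr => k _.
by rewrite mulr_sumr; apply: eq_bigr => l _; ring.
Qed.

Lemma gramL_diag c : gramL c c =
  \sum_(i < m) \sum_(j < m) c i j ^+ 2 * (cheb_gram i i * cheb_gram j j).
Proof.
apply: eq_bigr => i _; apply: eq_bigr => j _.
rewrite (bigD1 i)//= (bigD1 j)//= [X in _ + X + _]big1 => [|l lj]; last first.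
  by rewrite (@cheb_gram_neq j l) ?mulr0// eq_sym.
rewrite [X in _ + X]big1 => [|k ki]; first by rewrite !addr0 expr2.
by rewrite big1// => l _; rewrite cheb_gram_neq ?mul0r ?mulr0// eq_sym.
Qed.

(** The form is diagonal with positive entries; indices in the index set fall within the summation
    box, and elsewhere the coefficient vanishes by hypothesis. *)
Lemma gramL_eq0 c i j : supportL c -> gramL c c = 0 -> c i j = 0.
Proof.
move=> cG; rewrite gramL_diag => c0.
have [ij|] := boolP (GammaL n p i j); last exact: cG.
have pos k l : 0 <= c k l ^+ 2 * (cheb_gram k k * cheb_gram l l).
  by rewrite mulr_ge0 ?sqr_ge0// mulr_ge0// ltW// cheb_gram_gt0.
have := psumr_eq0P (fun k _ => sumr_ge0 _ (fun l _ => pos _ _)) c0.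
move=> /(_ (Ordinal (GammaL_ltl n_gt0 p_gt0 ij)) isT).
move/(psumr_eq0P (fun l _ => pos _ _)).
move=> /(_ (Ordinal (GammaL_ltr n_gt0 p_gt0 ij)) isT) /eqP /=.
by rewrite mulf_eq0 sqrf_eq0 mulf_eq0 !(gt_eqF (cheb_gram_gt0 _)) /= orbF => /eqP.
Qed.

Lemma has_int_cheb_mul i k :
  has_int mu `[-1, 1] (fun x => cheb i x * cheb k x * cheb_weight x)
    (pi * cheb_gram i k).
Proof.
have H := has_int_lin (2^-1) (2^-1) (has_int_cheb R (i + k))
  (has_int_cheb R `|i - k|%N) (measurable_itv _).
have -> : pi * cheb_gram i k = 2^-1 * (pi * ((i + k)%N == 0%N)%:R) +
    2^-1 * (pi * (`|i - k|%N == 0%N)%:R) by rewrite /cheb_gram; field.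
by apply: has_int_ext H => // x _; rewrite cheb_mul; field.
Qed.

Lemma ipCheb_polyL c d : ipCheb (polyL c) (polyL d) = (gramL c d)%:E.
Proof.
have inner x : has_int mu `[-1, 1]
  (fun y => polyL c x y * polyL d x y / (Num.sqrt (1 - x ^+ 2) * Num.sqrt (1 - y ^+ 2)))
  (\sum_(i < m) \sum_(j < m) \sum_(k < m) \sum_(l < m)
    (pi * (c i j * d k l * cheb_gram j l)) * (cheb i x * cheb k x * cheb_weight x)).
  have H : has_int mu `[-1, 1] (fun y => \sum_(i < m) \sum_(j < m) \sum_(k < m) \sum_(l < m)
    (c i j * d k l * (cheb i x * cheb k x * cheb_weight x)) *
       (cheb j y * cheb l y * cheb_weight y))
    (\sum_(i < m) \sum_(j < m) \sum_(k < m) \sum_(l < m)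
    (c i j * d k l * (cheb i x * cheb k x * cheb_weight x)) * (pi * cheb_gram j l)).
    do 4 (apply: has_int_sum => // ?).
    by apply: has_intZ => //; exact: has_int_cheb_mul.
  have -> : \sum_(i < m) \sum_(j < m) \sum_(k < m) \sum_(l < m)
    (pi * (c i j * d k l * cheb_gram j l)) * (cheb i x * cheb k x * cheb_weight x) =
    \sum_(i < m) \sum_(j < m) \sum_(k < m) \sum_(l < m)
    (c i j * d k l * (cheb i x * cheb k x * cheb_weight x)) * (pi * cheb_gram j l).
    by do 4 (apply: eq_bigr => ? _); ring.
  apply: has_int_ext H => // y _; rewrite polyL_mul invfM !mulr_suml.
  do 4 (rewrite ?mulr_suml; apply: eq_bigr => ? _).
  by rewrite /cheb_weight; ring.
have outer : has_int mu `[-1, 1]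
  (fun x => \sum_(i < m) \sum_(j < m) \sum_(k < m) \sum_(l < m)
    (pi * (c i j * d k l * cheb_gram j l)) * (cheb i x * cheb k x * cheb_weight x))
  (\sum_(i < m) \sum_(j < m) \sum_(k < m) \sum_(l < m)
    (pi * (c i j * d k l * cheb_gram j l)) * (pi * cheb_gram i k)).
  do 4 (apply: has_int_sum => // ?).
  by apply: has_intZ => //; exact: has_int_cheb_mul.
rewrite /ipCheb; under eq_integral => x _ do rewrite (inner x).2.
rewrite outer.2 -EFinM; congr EFin.
have pi2 : pi ^+ 2 != 0 :> R by rewrite sqrf_eq0 gt_eqF// pi_gt0.
apply: (mulfI pi2); rewrite mulrA divff// mul1r /gramL.
do 4 (rewrite ?mulr_sumr; apply: eq_bigr => ? _).
by ring.
Qed.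

Hypotheses (p_odd : odd p) (nq_coprime : coprime n q).

(* The resonance n u = q v, i.e. (u, v) = (a q, a n), contributes cos (a p pi/2),
   which vanishes for a = 1 because p is odd. *)
Lemma has_int_trace_cheb (u v : nat) : ((n * u)%N = (q * v)%N -> (u < 2 * q)%N) ->
  has_int mu `[0, 2 * pi]
    (fun t => cheb u (gamma n p t).1 * cheb v (gamma n p t).2)
    (2 * pi * ((u == 0%N)%:R * (v == 0%N)%:R)).
Proof.
move=> uv2.
have H1 := has_int_cos (n%:Z * u%:Z + q%:Z * v%:Z) (- ((u%:R + v%:R) * (pi / 2)) : R).
have H2 := has_int_cos (n%:Z * u%:Z - q%:Z * v%:Z) (- ((u%:R - v%:R) * (pi / 2)) : R).
have H := has_int_lin (2^-1) (2^-1) H1 H2 (measurable_itv _).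
suff E : 2 * pi * ((u == 0%N)%:R * (v == 0%N)%:R) =
    2^-1 * (2 * pi * ((n%:Z * u%:Z + q%:Z * v%:Z == 0)%:R *
      cos (- ((u%:R + v%:R) * (pi / 2))))) +
    2^-1 * (2 * pi * ((n%:Z * u%:Z - q%:Z * v%:Z == 0)%:R *
      cos (- ((u%:R - v%:R) * (pi / 2))))) :> R.
  rewrite E; apply: has_int_ext H => // t _.
  rewrite cheb_gamma cos_mul_cos intrD intrB !intrM -!pmulrn.
  rewrite [RHS]mulrDl !(mulrC (2^-1)); congr (cos _ / _ + cos _ / _);
    by rewrite /angx /angy; ring.
have [nuqv|nuqv] := eqVneq (n * u)%N (q * v)%N; last first.
  have -> : (n%:Z * u%:Z + q%:Z * v%:Z == 0) = false.
    by apply/negbTE/eqP => E; move/eqP: nuqv; lia.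
  have -> : (n%:Z * u%:Z - q%:Z * v%:Z == 0) = false.
    by apply/negbTE/eqP => E; move/eqP: nuqv; lia.
  have -> : (u == 0%N)%:R * (v == 0%N)%:R = 0 :> R.
    case: (eqVneq u 0%N) nuqv => [->|_ _]; rewrite ?mul0r//.
    by case: (eqVneq v 0%N) => [->|_ _]; rewrite ?mulr0// !muln0 eqxx.
  by rewrite !mulr0n; ring.
have q_gt0 : (0 < q)%N by rewrite addn_gt0 n_gt0.
have -> : n%:Z * u%:Z - q%:Z * v%:Z == 0 by apply/eqP; lia.
have : (q %| u)%N.
  by rewrite -(@Gauss_dvdr q n u) 1?coprime_sym// nuqv dvdn_mulr.
case/dvdnP => a uE.
have vE : v = (a * n)%N.
  by apply/eqP; rewrite -(eqn_pmul2l q_gt0) -nuqv uE; apply/eqP; lia.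
have a2 : (a < 2)%N by rewrite -(ltn_pmul2r q_gt0) -uE uv2.
case: a uE vE a2 => [|[|//]] uE vE _.
  by rewrite uE vE !mul0n !mulr0 !addr0 subr0 !mul0r oppr0 cos0 !eqxx !mulr1n; field.
have -> : (n%:Z * u%:Z + q%:Z * v%:Z == 0) = false.
  have nu_gt0 : (0 < n * u)%N by rewrite uE mul1n muln_gt0 n_gt0.
  by apply/negbTE/eqP; lia.
have -> : (u == 0%N) = false by rewrite uE mul1n gtn_eqF.
have [c0 _] := @cos_p_pi2 R p p_odd 0 ltac:(by rewrite mul0r sin0).
have -> : - ((u%:R - v%:R) * (pi / 2)) = - (0 * pi + p%:R * (pi / 2)) :> R.
  by rewrite uE vE !mul1n natrD; ring.
by rewrite !cosN c0 !mulr0n; ring.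
Qed.

(** If u >= 2q, resonance gives n u + q v = 2 n u >= 4nq, while each index pair has n i + q j <=
    2nq. Equality then holds throughout, which in the index set forces i = k = 0, hence u = 0. *)
Lemma GammaL_nonresonant i j k l u v : GammaL n p i j -> GammaL n p k l ->
  (u <= i + k)%N -> (v <= j + l)%N -> (n * u)%N = (q * v)%N -> (u < 2 * q)%N.
Proof.
have bound i' j' : GammaL n p i' j' -> (n * i' + q * j' <= 2 * n * q)%N /\
    ((n * i' + q * j')%N = (2 * n * q)%N -> i' = 0%N).
  rewrite GammaLE// => /orP[ij|/andP[/eqP-> /eqP->]]; last by split=> //; lia.
  by split=> [|E]; lia.
move=> /bound[ij1 ij2] /bound[kl1 kl2] ui vj uv; rewrite ltnNge; apply/negP => qu.
have h1 := leq_mul (leqnn n) ui; have h2 := leq_mul (leqnn q) vj.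
have h3 := leq_mul (leqnn n) qu.
have i0 : i = 0%N by apply: ij2; lia.
have k0 : k = 0%N by apply: kl2; lia.
move: qu ui; rewrite i0 k0 addn0 leqn0 => qu /eqP u0.
by move: qu; rewrite u0; lia.
Qed.

(** The product formula in each variable yields four terms, with u one of i + k, |i - k| and v one
    of j + l, |j - l|; none of them meets a resonance with u >= 2q. *)
Lemma has_int_trace_mul i j k l : GammaL n p i j -> GammaL n p k l ->
  has_int mu `[0, 2 * pi]
    (fun t => cheb i (gamma n p t).1 * cheb k (gamma n p t).1 *
              (cheb j (gamma n p t).2 * cheb l (gamma n p t).2))
    (2 * pi * (cheb_gram i k * cheb_gram j l)).
Proof.
move=> ij kl.
have le_dist (a b : nat) : (`|a - b|%N <= a + b)%N by lia.
have H u v : (u <= i + k)%N -> (v <= j + l)%N -> has_int mu `[0, 2 * pi]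
    (fun t => cheb u (gamma n p t).1 * cheb v (gamma n p t).2)
    (2 * pi * ((u == 0%N)%:R * (v == 0%N)%:R)).
  by move=> ui vj; apply: has_int_trace_cheb; exact: GammaL_nonresonant ui vj.
have K := has_int_lin (4^-1) (4^-1)
  (has_int_lin 1 1 (H _ _ (leqnn _) (leqnn _)) (H _ _ (leqnn _) (le_dist j l))
    (measurable_itv _))
  (has_int_lin 1 1 (H _ _ (le_dist i k) (leqnn _)) (H _ _ (le_dist i k) (le_dist j l))
    (measurable_itv _)) (measurable_itv _).
rewrite /cheb_gram.
set I := ((i + k)%N == 0%N)%:R in K *; set I' := (`|i - k|%N == _)%:R in K *.
set J := ((j + l)%N == 0%N)%:R in K *; set J' := (`|j - l|%N == _)%:R in K *.
have -> : 2 * pi * ((I + I') / 2 * ((J + J') / 2)) =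
   4^-1 * (1 * (2 * pi * (I * J)) + 1 * (2 * pi * (I * J'))) +
   4^-1 * (1 * (2 * pi * (I' * J)) + 1 * (2 * pi * (I' * J'))) by field.
by apply: has_int_ext K => // t _; rewrite !cheb_mul; field.
Qed.

Lemma ipTrig_polyL c d : supportL c -> supportL d ->
  ipTrig (Egamma n p (polyL c)) (Egamma n p (polyL d)) = (gramL c d)%:E.
Proof.
move=> cG dG.
have H : has_int mu `[0, 2 * pi]
  (fun t => \sum_(i < m) \sum_(j < m) \sum_(k < m) \sum_(l < m) c i j * d k l *
     (cheb i (gamma n p t).1 * cheb k (gamma n p t).1 *
              (cheb j (gamma n p t).2 * cheb l (gamma n p t).2)))
  (\sum_(i < m) \sum_(j < m) \sum_(k < m) \sum_(l < m)
    c i j * d k l * (2 * pi * (cheb_gram i k * cheb_gram j l))).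
  apply: has_int_sum => // i; apply: has_int_sum => // j.
  apply: has_int_sum => // k; apply: has_int_sum => // l.
  have [ij|/cG c0] := boolP (GammaL n p i j); last first.
    rewrite c0 !mul0r; apply: has_int_ext (has_int0 mu (measurable_itv _)) => // t _.
    by rewrite !mul0r.
  have [kl|/dG d0] := boolP (GammaL n p k l); last first.
    rewrite d0 mulr0 mul0r; apply: has_int_ext (has_int0 mu (measurable_itv _)) => // t _.
    by rewrite !mul0r.
  by apply: has_intZ => //; exact: has_int_trace_mul.
rewrite /ipTrig /Egamma; under eq_integral => t _ do rewrite polyL_mul.
rewrite H.2 -EFinM; congr EFin.
have pi2 : 2 * pi != 0 :> R by rewrite mulf_neq0 ?pnatr_eq0// gt_eqF// pi_gt0.
apply: (mulfI pi2); rewrite mulrA divff// mul1r /gramL.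
do 4 (rewrite ?mulr_sumr; apply: eq_bigr => ? _).
by ring.
Qed.

Lemma Egamma_isometry P Q : PiL n p P -> PiL n p Q ->
  ipTrig (Egamma (R := R) n p P) (Egamma n p Q) = ipCheb P Q.
Proof.
by move=> /PiL_polyL[c cG ->] /PiL_polyL[d dG ->]; rewrite ipTrig_polyL// ipCheb_polyL.
Qed.

Lemma Egamma_inj P Q : PiL n p P -> PiL n p Q ->
  Egamma (R := R) n p P = Egamma n p Q -> P = Q.
Proof.
move=> /PiL_polyL[c cG ->] /PiL_polyL[d dG ->] cd.
pose e i j := c i j - d i j.
have eG : supportL e by move=> i j ij; rewrite /e cG// dG// subrr.
have polyLB x y : polyL e x y = polyL c x y - polyL d x y.
  rewrite /polyL -sumrB; apply: eq_bigr => i _; rewrite -sumrB.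
  by apply: eq_bigr => j _; rewrite /e; ring.
have gram0 : gramL e e = 0.
  apply: EFin_inj; rewrite -ipTrig_polyL//.
  have e0 : Egamma n p (polyL e) = fun=> 0.
    apply/funext => t; rewrite /Egamma polyLB.
    by have := congr1 (fun f => f t) cd; rewrite /Egamma => ->; rewrite subrr.
  rewrite /ipTrig e0; under eq_integral do rewrite mulr0.
  by rewrite integral0 mule0.
(* All coefficients of the difference vanish, so equality holds on the whole plane and not only on
   the square. *)
apply/funext => x; apply/funext => y; apply/eqP; rewrite -subr_eq0 -polyLB.
rewrite /polyL big1// => i _; rewrite big1// => j _.
by rewrite (gramL_eq0 _ _ eG gram0) !mul0r.
Qed.

End Isometry.

Theorem theorem2 (R : realType) (n p : nat) :
  (0 < n)%N -> (0 < p)%N -> odd p -> coprime n (n + p) ->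
  [/\ (forall P : R -> R -> R, PiL n p P -> PiTrigL n p (Egamma n p P)),
      (forall P Q : R -> R -> R, PiL n p P -> PiL n p Q -> Egamma n p P = Egamma n p Q -> P = Q),
      (forall q : R -> R, PiTrigL n p q -> exists2 P, PiL n p P & Egamma n p P = q)
    & (forall P Q : R -> R -> R, PiL n p P -> PiL n p Q ->
         ipTrig (Egamma n p P) (Egamma n p Q) = ipCheb P Q)].
Proof.
move=> n_gt0 p_gt0 p_odd nq_coprime; split.
- by move=> P; exact: PiTrigL_Egamma.
- by move=> P Q; exact: Egamma_inj.
- by move=> f; exact: PiTrigL_is_trace.
- by move=> P Q; exact: Egamma_isometry.
Qed.
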